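(* Let $\mathcal{Q}$ be a small quantaloid and let $(F,G):(\phi:\mathbb{A}\rightsquigarrow\mathbb{B})\to(\psi:\mathbb{A}'\rightsquigarrow\mathbb{B}')$ be an infomorphism between $\mathcal{Q}$-distributors. Then $G:(\mathbb{B}',\psi_*\circ\psi^* )\to(\mathbb{B},\phi_*\circ\phi^* )$ is a continuous $\mathcal{Q}$-functor between $\mathcal{Q}$-closure spaces.
   Context: A quantaloid $\mathcal{Q}$ is a category whose hom-sets are complete lattices and whose composition preserves arbitrary joins in each variable; it is small if its objects $\mathcal{Q}_0$ and arrows form sets. For $f:X\to Y$, $h:X\to Z$ in a quantaloid, $h\swarrow f:Y\to Z$ is the largest arrow with $(h\swarrow f)\circ f\le h$. A $\mathcal{Q}$-category $\mathbb{A}$ is a set $\mathbb{A}_0$ with a type map $t:\mathbb{A}_0\to\mathcal{Q}_0$ and hom-arrows $\mathbb{A}(x,y)\in\mathcal{Q}(tx,ty)$ with $1_{tx}\le\mathbb{A}(x,x)$ and $\mathbb{A}(y,z)\circ\mathbb{A}(x,y)\le\mathbb{A}(x,z)$. A $\mathcal{Q}$-functor $F:\mathbb{A}\to\mathbb{B}$ is a type-preserving map with $\mathbb{A}(x,x')\le\mathbb{B}(Fx,Fx')$. The underlying preorder on $\mathbb{A}_0$ is: $x\le y$ iff $tx=ty$ and $1_{tx}\le\mathbb{A}(x,y)$; $\mathcal{Q}$-functors are ordered pointwise. A $\mathcal{Q}$-distributor $\phi:\mathbb{A}\rightsquigarrow\mathbb{B}$ assigns to each $(x,y)\in\mathbb{A}_0\times\mathbb{B}_0$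 an arrow $\phi(x,y)\in\mathcal{Q}(tx,ty)$ with $\mathbb{B}(y',y)\circ\phi(x,y')\le\phi(x,y)$ and $\phi(x',y)\circ\mathbb{A}(x,x')\le\phi(x,y)$. $\mathcal{Q}$-categories and $\mathcal{Q}$-distributors form a quantaloid with pointwise order, composition $(\psi\circ\phi)(x,z)=\bigvee_y\psi(y,z)\circ\phi(x,y)$, identities given by hom-arrows, and $(\eta\swarrow\phi)(y,z)=\bigwedge_x\eta(x,z)\swarrow\phi(x,y)$. For $X\in\mathcal{Q}_0$, $*_X$ is the $\mathcal{Q}$-category with one object of type $X$ and hom-arrow $1_X$. $\mathcal{P}\mathbb{A}$ has as objects of type $X$ the distributors $\mu:\mathbb{A}\rightsquigarrow *_X$, with $\mathcal{P}\mathbb{A}(\mu,\lambda)=\lambda\swarrow\mu$. For $\phi:\mathbb{A}\rightsquigarrow\mathbb{B}$, the $\mathcal{Q}$-functors $\phi^*:\mathcal{P}\mathbb{B}\to\mathcal{P}\mathbb{A}$, $\phi^*(\lambda)=\lambda\circ\phi$, and $\phi_*:\mathcal{P}\mathbb{A}\to\mathcal{P}\mathbb{B}$, $\phi_*(\mu)=\mu\swarrow\phi$, satisfy $\phi^*\dashv\phi_*$. An infomorphism $(F,G):\phi\to\psi$ from $\phi:\mathbb{A}\rightsquigarrow\mathbb{B}$ to $\psi:\mathbb{A}'\rightsquigarrow\mathbb{B}'$ is a pair of $\mathcal{Q}$-functors $F:\mathbb{A}\to\mathbb{A}'$, $G:\mathbb{B}'\to\mathbb{B}$ with $\phi(x,Gy')=\psi(Fx,y')$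 for all $x\in\mathbb{A}_0$, $y'\in\mathbb{B}'_0$. A $\mathcal{Q}$-closure space is a pair $(\mathbb{A},C)$ of a $\mathcal{Q}$-category $\mathbb{A}$ and a $\mathcal{Q}$-functor $C:\mathcal{P}\mathbb{A}\to\mathcal{P}\mathbb{A}$ with $1\le C$ and $C\circ C=C$; for example $(\mathbb{B},\phi_*\circ\phi^* )$. A continuous $\mathcal{Q}$-functor $H:(\mathbb{A},C)\to(\mathbb{B},D)$ is a $\mathcal{Q}$-functor $H:\mathbb{A}\to\mathbb{B}$ with $H^{\rightarrow}\circ C\le D\circ H^{\rightarrow}$, where $H^{\rightarrow}:\mathcal{P}\mathbb{A}\to\mathcal{P}\mathbb{B}$ is $H^{\rightarrow}(\mu)=\mu\circ H^{\natural}$ and $H^{\natural}:\mathbb{B}\rightsquigarrow\mathbb{A}$ is $H^{\natural}(y,x)=\mathbb{B}(y,Hx)$. *)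

(* Defs.v *)
From mathcomp Require Import all_boot all_order.
From mathcomp Require Import boolp classical_sets.

Set Implicit Arguments.
Unset Strict Implicit.
Unset Printing Implicit Defensive.
Import Order.TTheory.

Declare Scope quantaloid_scope.
Delimit Scope quantaloid_scope with Q.
Local Open Scope classical_set_scope.
Local Open Scope order_scope.
Local Open Scope quantaloid_scope.

(* Complete lattices are presented as posets with all (small) suprema;
   arbitrary infima are derived in [qinf]. *)
Record quantaloid (d : Order.disp_t) := Quantaloid {
  qobj : Type;
  qhom : qobj -> qobj -> porderType d;
  qid : forall X, qhom X X;
  qcomp : forall X Y Z, qhom Y Z -> qhom X Y -> qhom X Z;
  qsup : forall X Y, set (qhom X Y) -> qhom X Y;
  qcompA : forall X Y Z W (h : qhom Z W) (g : qhom Y Z) (f : qhom X Y),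
    qcomp h (qcomp g f) = qcomp (qcomp h g) f;
  qcomp1f : forall X Y (f : qhom X Y), qcomp (qid Y) f = f;
  qcompf1 : forall X Y (f : qhom X Y), qcomp f (qid X) = f;
  qsupP : forall X Y (S : set (qhom X Y)), isLub S (qsup S);
  qcomp_supl : forall X Y Z (S : set (qhom Y Z)) (f : qhom X Y),
    qcomp (qsup S) f = qsup [set qcomp g f | g in S];
  qcomp_supr : forall X Y Z (g : qhom Y Z) (S : set (qhom X Y)),
    qcomp g (qsup S) = qsup [set qcomp g f | f in S] }.

Arguments qid {d q} X.
Notation "g ∘ f" := (qcomp g f) (at level 40, left associativity)
  : quantaloid_scope.

Section QuantaloidTheory.
Variables (d : Order.disp_t) (Q : quantaloid d).

Definition qinf (X Y : qobj Q) (S : set (qhom X Y)) : qhom X Y :=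
  qsup (lbound S).

Definition qimpl (X Y Z : qobj Q) (h : qhom X Z) (f : qhom X Y) : qhom Y Z :=
  qsup [set g : qhom Y Z | g ∘ f <= h].

(* Transport of an arrow along equalities of its domain and codomain: types
   are compared propositionally below. *)
Definition qcast (X Y X' Y' : qobj Q) (eX : X = X') (eY : Y = Y')
    (f : qhom X Y) : qhom X' Y' :=
  match eX in _ = X1, eY in _ = Y1 return qhom X1 Y1 with
  | erefl, erefl => f
  end.

Lemma qsup_ub (X Y : qobj Q) (S : set (qhom X Y)) f : S f -> f <= qsup S.
Proof. by case: (qsupP S) => + _; apply. Qed.

Lemma qsup_le (X Y : qobj Q) (S : set (qhom X Y)) f :
  (forall g, S g -> g <= f) -> qsup S <= f.
Proof. by case: (qsupP S) => _; apply. Qed.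

Lemma qinf_lb (X Y : qobj Q) (S : set (qhom X Y)) f : S f -> qinf S <= f.
Proof. by move=> Sf; apply: qsup_le => g; apply. Qed.

Lemma qinf_ge (X Y : qobj Q) (S : set (qhom X Y)) f :
  (forall g, S g -> f <= g) -> f <= qinf S.
Proof. by move=> fS; apply: qsup_ub. Qed.

Lemma qsup_pair (X Y : qobj Q) (f g : qhom X Y) :
  f <= g -> qsup [set f; g] = g.
Proof.
move=> fg; apply/le_anti/andP; split; last by apply: qsup_ub; right.
by apply: qsup_le => h [->|->].
Qed.

Lemma qcomp_le2l (X Y Z : qobj Q) (g g' : qhom Y Z) (f : qhom X Y) :
  g <= g' -> g ∘ f <= g' ∘ f.
Proof.
move=> /qsup_pair <-; rewrite qcomp_supl; apply: qsup_ub.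
by exists g => //; left.
Qed.

Lemma qcomp_le2r (X Y Z : qobj Q) (g : qhom Y Z) (f f' : qhom X Y) :
  f <= f' -> g ∘ f <= g ∘ f'.
Proof.
move=> /qsup_pair <-; rewrite qcomp_supr; apply: qsup_ub.
by exists f => //; left.
Qed.

Lemma qimplP (X Y Z : qobj Q) (h : qhom X Z) (f : qhom X Y) (g : qhom Y Z) :
  (g <= qimpl h f) <-> (g ∘ f <= h).
Proof.
split=> [le_g|]; last by move=> ?; apply: qsup_ub.
apply: le_trans (qcomp_le2l f le_g) _.
by rewrite qcomp_supl; apply: qsup_le => _ [k kh <-].
Qed.

End QuantaloidTheory.

Notation "h ↙ f" := (qimpl h f) (at level 40, left associativity)
  : quantaloid_scope.

Record qcat (d : Order.disp_t) (Q : quantaloid d) := QCat {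
  qcar :> Type;
  qtype : qcar -> qobj Q;
  qarr : forall x y : qcar, qhom (qtype x) (qtype y);
  qarr_id : forall x, qid (qtype x) <= qarr x x;
  qarr_comp : forall x y z, qarr y z ∘ qarr x y <= qarr x z }.

Arguments qtype {d Q} q x.
Arguments qarr {d Q} q x y.

Record qfunctor (d : Order.disp_t) (Q : quantaloid d) (A B : qcat Q) :=
  QFunctor {
  qfun :> A -> B;
  qfun_type : forall x, qtype B (qfun x) = qtype A x;
  qfun_le : forall x x', qarr A x x' <=
    qcast (qfun_type x) (qfun_type x') (qarr B (qfun x) (qfun x')) }.

Record distributor (d : Order.disp_t) (Q : quantaloid d) (A B : qcat Q) :=
  Distributor {
  dval :> forall (x : A) (y : B), qhom (qtype A x) (qtype B y);
  dval_compl : forall x y' y, qarr B y' y ∘ dval x y' <= dval x y;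
  dval_compr : forall x x' y, dval x' y ∘ qarr A x x' <= dval x y }.

Section QCategories.
Variables (d : Order.disp_t) (Q : quantaloid d).

Definition under_le (A : qcat Q) (x y : A) : Prop :=
  exists e : qtype A x = qtype A y,
    qid (qtype A x) <= qcast erefl (esym e) (qarr A x y).

Definition qfunctor_le (A B : qcat Q) (F G : qfunctor A B) : Prop :=
  forall x, under_le (F x) (G x).

Lemma qfunctor_eq (A B : qcat Q) (F G : qfunctor A B) : F =1 G -> F = G.
Proof.
case: F G => [f ft fle] [g gt gle] /= /funext fg.
subst g; have e : ft = gt by exact: Prop_irrelevance.
by subst gt; congr QFunctor; exact: Prop_irrelevance.
Qed.

Definition qfunctor_id (A : qcat Q) : qfunctor A A :=
  @QFunctor d Q A A id (fun=> erefl) (fun x x' => lexx (qarr A x x')).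

Lemma qcast_le (X Y X' Y' : qobj Q) (eX : X = X') (eY : Y = Y')
  (f g : qhom X Y) : f <= g -> qcast eX eY f <= qcast eX eY g.
Proof. by case: X' / eX; case: Y' / eY. Qed.

Lemma qcast_trans (X Y X' Y' X'' Y'' : qobj Q) (eX : X = X') (eY : Y = Y')
    (eX' : X' = X'') (eY' : Y' = Y'') (f : qhom X Y) :
  qcast eX' eY' (qcast eX eY f) = qcast (etrans eX eX') (etrans eY eY') f.
Proof. by case: X'' / eX'; case: Y'' / eY'; case: X' / eX; case: Y' / eY. Qed.

Lemma qcast_comp (X Y Z X' Y' Z' : qobj Q) (eX : X = X') (eY : Y = Y')
    (eZ : Z = Z') (g : qhom Y Z) (f : qhom X Y) :
  qcast eX eZ (g ∘ f) = qcast eY eZ g ∘ qcast eX eY f.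
Proof. by case: X' / eX; case: Y' / eY; case: Z' / eZ. Qed.

Lemma qfunctor_comp_le (A B C : qcat Q) (G : qfunctor B C) (F : qfunctor A B)
    x x' :
  qarr A x x' <=
    qcast (etrans (qfun_type G (F x)) (qfun_type F x))
          (etrans (qfun_type G (F x')) (qfun_type F x'))
      (qarr C (G (F x)) (G (F x'))).
Proof.
rewrite -qcast_trans; apply: le_trans (qfun_le F x x') _.
exact/qcast_le/qfun_le.
Qed.

Definition qfunctor_comp (A B C : qcat Q) (G : qfunctor B C)
    (F : qfunctor A B) : qfunctor A C :=
  @QFunctor d Q A C (fun x => G (F x))
    (fun x => etrans (qfun_type G (F x)) (qfun_type F x))
    (qfunctor_comp_le G F).

Definition dle (A B : qcat Q) (phi psi : distributor A B) : Prop :=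
  forall x y, phi x y <= psi x y.

Lemma dle_trans (A B : qcat Q) (chi phi psi : distributor A B) :
  dle phi chi -> dle chi psi -> dle phi psi.
Proof. by move=> h k x y; apply: le_trans (h x y) (k x y). Qed.

Lemma dle_anti (A B : qcat Q) (phi psi : distributor A B) :
  dle phi psi -> dle psi phi -> phi = psi.
Proof.
case: phi psi => [f fl fr] [g gl gr] fg gf.
have e : f = g.
  apply: functional_extensionality_dep => x.
  apply: functional_extensionality_dep => y.
  by apply/le_anti/andP; split; [exact: fg|exact: gf].
by subst g; congr Distributor; exact: Prop_irrelevance.
Qed.

Section Composition.
Variables (A B C : qcat Q) (psi : distributor B C) (phi : distributor A B).

Let comp x z := qsup (range (fun y => psi y z ∘ phi x y)).

Lemma dcomp_compl x z' z : qarr C z' z ∘ comp x z' <= comp x z.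
Proof.
rewrite qcomp_supr; apply: qsup_le => _ [_ [y _ <-] <-].
rewrite qcompA; apply: le_trans (qcomp_le2l _ (dval_compl psi y z' z)) _.
by apply: qsup_ub; exists y.
Qed.

Lemma dcomp_compr x x' z : comp x' z ∘ qarr A x x' <= comp x z.
Proof.
rewrite qcomp_supl; apply: qsup_le => _ [_ [y _ <-] <-].
rewrite -qcompA; apply: le_trans (qcomp_le2r _ (dval_compr phi x x' y)) _.
by apply: qsup_ub; exists y.
Qed.

Definition dcomp : distributor A C := Distributor dcomp_compl dcomp_compr.

End Composition.

Section Implication.
Variables (A B C : qcat Q) (eta : distributor A C) (phi : distributor A B).

Let impl y z := qinf (range (fun x => eta x z ↙ phi x y)).

Lemma dimpl_compl y z' z : qarr C z' z ∘ impl y z' <= impl y z.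
Proof.
apply: qinf_ge => _ [x _ <-]; apply/qimplP; rewrite -qcompA.
apply: le_trans (dval_compl eta x z' z); apply: qcomp_le2r.
by apply/qimplP; apply: qinf_lb; exists x.
Qed.

Lemma dimpl_compr y y' z : impl y' z ∘ qarr B y y' <= impl y z.
Proof.
apply: qinf_ge => _ [x _ <-]; apply/qimplP; rewrite -qcompA.
apply: le_trans (qcomp_le2r _ (dval_compl phi x y y')) _.
by apply/qimplP; apply: qinf_lb; exists x.
Qed.

Definition dimpl : distributor B C := Distributor dimpl_compl dimpl_compr.

End Implication.

Lemma dimplP (A B C : qcat Q) (eta : distributor A C) (phi : distributor A B)
    (psi : distributor B C) : dle psi (dimpl eta phi) <-> dle (dcomp psi phi) eta.
Proof.
split=> h.
  move=> x z; apply: qsup_le => _ [y _ <-]; apply/qimplP.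
  by apply: le_trans (h y z) _; apply: qinf_lb; exists x.
move=> y z; apply: qinf_ge => _ [x _ <-]; apply/qimplP.
by apply: le_trans (h x z); apply: qsup_ub; exists y.
Qed.

Lemma dimpl_le (A B C : qcat Q) (eta eta' : distributor A C)
    (phi : distributor A B) :
  dle eta eta' -> dle (dimpl eta phi) (dimpl eta' phi).
Proof. by move=> h; apply/dimplP; apply: dle_trans h; apply/dimplP => x y. Qed.

Lemma one_obj_comp (X : qobj Q) : qid X ∘ qid X <= qid X.
Proof. by rewrite qcomp1f. Qed.

Definition one_obj (X : qobj Q) : qcat Q :=
  @QCat d Q unit (fun=> X) (fun _ _ => qid X) (fun=> lexx (qid X))
    (fun _ _ _ => one_obj_comp X).

Record presheaf (A : qcat Q) := Presheaf {
  psh_type : qobj Q;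
  psh_dist :> distributor A (one_obj psh_type) }.

(* [dimpl lambda mu] is a distributor between one-object categories, i.e. a
   single arrow from the type of mu to the type of lambda. *)
Definition presheaf_arr (A : qcat Q) (mu lambda : presheaf A) :
    qhom (psh_type mu) (psh_type lambda) := dimpl lambda mu tt tt.

Lemma presheaf_arrP (A : qcat Q) (mu lambda : presheaf A) f :
  (f <= presheaf_arr mu lambda) <->
  (forall x, f ∘ mu x tt <= lambda x tt).
Proof.
split=> [h x|h].
  by apply/qimplP; apply: le_trans h _; apply: qinf_lb; exists x.
by apply: qinf_ge => _ [x _ <-]; apply/qimplP.
Qed.

Lemma presheaf_arr_id (A : qcat Q) (mu : presheaf A) :
  qid (psh_type mu) <= presheaf_arr mu mu.
Proof. by apply/presheaf_arrP => x; rewrite qcomp1f. Qed.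

Lemma presheaf_arr_comp (A : qcat Q) (mu lambda nu : presheaf A) :
  presheaf_arr lambda nu ∘ presheaf_arr mu lambda <= presheaf_arr mu nu.
Proof.
apply/presheaf_arrP => x; rewrite -qcompA.
have /presheaf_arrP/(_ x) h := lexx (presheaf_arr mu lambda).
apply: le_trans (qcomp_le2r _ h) _.
by have /presheaf_arrP/(_ x) := lexx (presheaf_arr lambda nu).
Qed.

Definition presheaf_cat (A : qcat Q) : qcat Q :=
  @QCat d Q (presheaf A) (@psh_type A) (@presheaf_arr A)
    (@presheaf_arr_id A) (@presheaf_arr_comp A).

Section KanAdjunction.
Variables (A B : qcat Q) (phi : distributor A B).

Let upper_fun (lambda : presheaf B) : presheaf A :=
  Presheaf (dcomp lambda phi).
Let lower_fun (mu : presheaf A) : presheaf B :=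
  Presheaf (dimpl mu phi).

Lemma dist_upper_le (lambda lambda' : presheaf B) :
  presheaf_arr lambda lambda' <=
  presheaf_arr (upper_fun lambda) (upper_fun lambda').
Proof.
apply/(@presheaf_arrP A (upper_fun lambda) (upper_fun lambda')) => x /=.
rewrite qcomp_supr.
apply: qsup_le => _ [_ [y _ <-] <-]; rewrite qcompA.
have /presheaf_arrP/(_ y) h := lexx (presheaf_arr lambda lambda').
by apply: le_trans (qcomp_le2l _ h) _; apply: qsup_ub; exists y.
Qed.

Lemma dist_lower_le (mu mu' : presheaf A) :
  presheaf_arr mu mu' <= presheaf_arr (lower_fun mu) (lower_fun mu').
Proof.
apply/(@presheaf_arrP B (lower_fun mu) (lower_fun mu')) => y /=.
apply: qinf_ge => _ [x _ <-].
apply/qimplP; rewrite -qcompA.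
have /presheaf_arrP/(_ x) := lexx (presheaf_arr mu mu').
apply: le_trans; apply: qcomp_le2r.
by apply/qimplP; apply: qinf_lb; exists x.
Qed.

(* $\phi^*$ *)
Definition dist_upper : qfunctor (presheaf_cat B) (presheaf_cat A) :=
  @QFunctor d Q (presheaf_cat B) (presheaf_cat A) upper_fun
    (fun=> erefl) dist_upper_le.

(* $\phi_*$ *)
Definition dist_lower : qfunctor (presheaf_cat A) (presheaf_cat B) :=
  @QFunctor d Q (presheaf_cat A) (presheaf_cat B) lower_fun
    (fun=> erefl) dist_lower_le.

End KanAdjunction.

Definition infomorphism (A B A' B' : qcat Q) (phi : distributor A B)
    (psi : distributor A' B') (F : qfunctor A A') (G : qfunctor B' B) : Prop :=
  forall (x : A) (y' : B'),
    qcast erefl (qfun_type G y') (phi x (G y')) =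
    qcast (qfun_type F x) erefl (psi (F x) y').

Record closure_space := ClosureSpace {
  cs_cat : qcat Q;
  cs_op : qfunctor (presheaf_cat cs_cat) (presheaf_cat cs_cat);
  cs_ge1 : qfunctor_le (qfunctor_id (presheaf_cat cs_cat)) cs_op;
  cs_idem : qfunctor_comp cs_op cs_op = cs_op }.

Section DistributorClosure.
Variables (A B : qcat Q) (phi : distributor A B).

Let C := qfunctor_comp (dist_lower phi) (dist_upper phi).

Lemma dist_closure_ge1 : qfunctor_le (qfunctor_id (presheaf_cat B)) C.
Proof.
move=> mu; exists erefl; apply/(@presheaf_arrP B mu (C mu)) => y.
rewrite qcomp1f.
by have /dimplP : dle (dcomp mu phi) (dcomp mu phi) by []; exact.
Qed.

Lemma dist_closure_idem : qfunctor_comp C C = C.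
Proof.
apply: qfunctor_eq => mu; apply: (congr1 (@Presheaf B (psh_type mu))).
apply: dle_anti; last by apply/dimplP.
by apply: dimpl_le; apply/dimplP.
Qed.

Definition dist_closure : closure_space :=
  ClosureSpace dist_closure_ge1 dist_closure_idem.

End DistributorClosure.

Section CoGraph.
Variables (A B : qcat Q) (H : qfunctor A B).

Let cograph_val (y : B) (x : A) : qhom (qtype B y) (qtype A x) :=
  qcast erefl (qfun_type H x) (qarr B y (H x)).

Lemma cograph_compl y x' x :
  qarr A x' x ∘ cograph_val y x' <= cograph_val y x.
Proof.
apply: le_trans (qcomp_le2l _ (qfun_le H x' x)) _.
by rewrite /cograph_val -qcast_comp; apply/qcast_le/qarr_comp.
Qed.

Lemma cograph_compr y y' x :
  cograph_val y' x ∘ qarr B y y' <= cograph_val y x.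
Proof.
rewrite /cograph_val -[qarr B y y']/(qcast erefl erefl (qarr B y y')).
by rewrite -qcast_comp; apply/qcast_le/qarr_comp.
Qed.

(* $H^\natural$ *)
Definition cograph : distributor B A := Distributor cograph_compl cograph_compr.

(* $H^\rightarrow(\mu) = \mu \circ H^\natural$, i.e. $(H^\natural)^*$ *)
Definition direct_image : qfunctor (presheaf_cat A) (presheaf_cat B) :=
  dist_upper cograph.

End CoGraph.

Definition is_continuous (S T : closure_space)
    (H : qfunctor (cs_cat S) (cs_cat T)) : Prop :=
  qfunctor_le (qfunctor_comp (direct_image H) (cs_op S))
              (qfunctor_comp (cs_op T) (direct_image H)).

End QCategories.

(* Main.v *)
(** The infomorphism condition says that $G^\natural \circ \phi$ is $\psi$
    precomposed with $F$.  Hence, for $\nu = \psi_*\psi^*\lambda$, the inequality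
    $\nu \circ \psi \le \lambda \circ \psi$ restricts along $F$ to
    $\nu \circ G^\natural \circ \phi \le \lambda \circ G^\natural \circ \phi$,
    which is the transpose of
    $G^\to(\psi_*\psi^*\lambda) \le \phi_*\phi^*(G^\to\lambda)$. *)

Require Import Defs.
From mathcomp Require Import all_boot all_order.
From mathcomp Require Import boolp classical_sets.

Set Implicit Arguments.
Unset Strict Implicit.
Unset Printing Implicit Defensive.
Import Order.TTheory.

Local Open Scope classical_set_scope.
Local Open Scope order_scope.
Local Open Scope quantaloid_scope.

Section Distributors.
Variables (d : Order.disp_t) (Q : quantaloid d).

Lemma qcast_sup (X Y X' Y' : qobj Q) (eX : X = X') (eY : Y = Y')
    (S : set (qhom X Y)) :
  qcast eX eY (qsup S) = qsup [set qcast eX eY f | f in S].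
Proof. by case: X' / eX; case: Y' / eY; rewrite /= image_id. Qed.

Lemma qcast_compl (X Y Z X' : qobj Q) (eX : X = X')
    (g : qhom Y Z) (f : qhom X Y) :
  qcast eX erefl (g ∘ f) = g ∘ qcast eX erefl f.
Proof. by case: X' / eX. Qed.

Lemma qcast_compr (X Y Z Z' : qobj Q) (eZ : Z = Z')
    (g : qhom Y Z) (f : qhom X Y) :
  qcast erefl eZ (g ∘ f) = qcast erefl eZ g ∘ f.
Proof. by case: Z' / eZ. Qed.

(** Composition distributes over joins in each variable, so both sides are the join of the triple
    composites over all pairs of intermediate objects. *)
Lemma dcompA (A B C D : qcat Q) (h : distributor C D) (g : distributor B C)
    (f : distributor A B) :
  dcomp h (dcomp g f) = dcomp (dcomp h g) f.
Proof.
apply: dle_anti => x z; apply: qsup_le => _ [y _ <-] /=.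
  rewrite qcomp_supr; apply: qsup_le => _ [_ [b _ <-] <-]; rewrite qcompA.
  apply: (@le_trans _ _ (dcomp h g b z ∘ f x b)); last first.
    by apply: qsup_ub; exists b.
  by apply: qcomp_le2l; apply: qsup_ub; exists y.
rewrite qcomp_supl; apply: qsup_le => _ [_ [c _ <-] <-]; rewrite -qcompA.
apply: (@le_trans _ _ (h c z ∘ dcomp g f x c)); last first.
  by apply: qsup_ub; exists c.
by apply: qcomp_le2r; apply: qsup_ub; exists y.
Qed.

(* The co-Yoneda reduction of the join defining [dcomp]. *)
Lemma dcomp_cographE (A B B' : qcat Q) (G : qfunctor B' B)
    (phi : distributor A B) x y' :
  dcomp (cograph G) phi x y' =
  qcast erefl (qfun_type G y') (phi x (G y')).
Proof.
apply/le_anti/andP; split.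
  apply: qsup_le => _ [y _ <-]; rewrite -qcast_compr.
  exact/qcast_le/dval_compl.
(* The term of the join at [G y'] suffices, as the identity lies below [qarr B (G y') (G y')]. *)
apply: (@le_trans _ _ (cograph G (G y') y' ∘ phi x (G y'))); last first.
  by apply: qsup_ub; exists (G y').
rewrite -qcast_compr; apply: qcast_le.
by rewrite -[leLHS]qcomp1f; apply/qcomp_le2l/qarr_id.
Qed.

(** Reassociating puts [cograph G] next to [phi], where the co-Yoneda reduction and the infomorphism
    condition apply to each term of the join. *)
Lemma dcomp_infomorphism (A B A' B' C : qcat Q) (phi : distributor A B)
    (psi : distributor A' B') (F : qfunctor A A') (G : qfunctor B' B)
    (nu : distributor B' C) x z :
  infomorphism phi psi F G ->
  dcomp (dcomp nu (cograph G)) phi x z =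
  qcast (qfun_type F x) erefl (dcomp nu psi (F x) z).
Proof.
move=> FG; rewrite -dcompA qcast_sup image_comp; congr qsup.
apply: eq_imagel => y' _.
by rewrite dcomp_cographE FG -qcast_compl.
Qed.

End Distributors.

Theorem proposition6p3p1 (d : Order.disp_t) (Q : quantaloid d)
    (A B A' B' : qcat Q) (phi : distributor A B) (psi : distributor A' B')
    (F : qfunctor A A') (G : qfunctor B' B)
    (FG : infomorphism phi psi F G) :
  @is_continuous d Q (dist_closure psi) (dist_closure phi) G.
Proof.
move=> lambda; exists erefl; set nu := dimpl (dcomp lambda psi) psi.
(* The counit of $\psi^* \dashv \psi_*$ at [dcomp lambda psi]. *)
have nu_le : dle (dcomp nu psi) (dcomp lambda psi) by apply/dimplP.
have /dimplP GC_le : dle (dcomp (dcomp nu (cograph G)) phi)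
    (dcomp (dcomp lambda (cograph G)) phi).
  by move=> x z; rewrite !(dcomp_infomorphism _ _ _ FG); exact/qcast_le/nu_le.
apply/(@presheaf_arrP _ _ B
  (Presheaf (dcomp nu (cograph G)))
  (Presheaf (dimpl (dcomp (dcomp lambda (cograph G)) phi) phi))) => y.
by rewrite qcomp1f; exact: GC_le.
Qed.
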